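(* Let $\mathcal A$ be a unital C$^*$-algebra. The action of the subgroup $\mathcal B\subset\mathcal U(\theta_H)$ on the Poincar\'e half-space $\mathcal H$ of $\mathcal A$ is transitive.
   Context: $G^+$ is the set of positive invertible elements of $\mathcal A$, $Im(h)=\frac1{2i}(h-h^* )$, and the Poincar\'e half-space is $\mathcal H=\{h\in\mathcal A: Im(h)\in G^+\}$. $M_2(\mathcal A)$ acts by left multiplication on column vectors in $\mathcal A^2$, and $Gl_2(\mathcal A)$ is the group of invertible elements of $M_2(\mathcal A)$. The $\mathcal A$-valued form $\theta_H$ on $\mathcal A^2$ is $\theta_H\left(\left(\begin{array}{c} x_1\\ x_2\end{array}\right),\left(\begin{array}{c} y_1\\ y_2\end{array}\right)\right)=\frac1i(x_1^*y_2-x_2^*y_1)$, and $$\mathcal U(\theta_H)=\{\tilde a\in Gl_2(\mathcal A):\theta_H(\tilde a\mathbf x,\tilde a\mathbf y)=\theta_H(\mathbf x,\mathbf y)\ \text{for all }\mathbf x,\mathbf y\in\mathcal A^2\}.$$ $\mathcal B$ is the group of all elements of $\mathcal U(\theta_H)$ of the form $\left(\begin{array}{cc}b_{11}&0\\ b_{21}&b_{22}\end{array}\right)$. The group $\mathcal U(\theta_H)$ acts on $\mathcal H$ on the left by $$\left(\begin{array}{cc}a_{11}&a_{12}\\ a_{21}&a_{22}\end{array}\right)\cdot h=(a_{21}+a_{22}h)(a_{11}+a_{12}h)^{-1}$$ (this is well defined). *)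

(* Defs.v *)
From HB Require Import structures.
From mathcomp Require Import all_boot all_order all_algebra.
From mathcomp Require Import complex.
From mathcomp Require Import boolp classical_sets reals.

Set Implicit Arguments.
Unset Strict Implicit.
Unset Printing Implicit Defensive.

Import Order.TTheory GRing.Theory Num.Theory.

Local Open Scope classical_set_scope.
Local Open Scope ring_scope.

(* A C*-algebra over the complex numbers R[i]. The norm is a field of the mixin
   because the library's normed modules cannot be joined with unit rings: the
   join would have to be declared before [Num.NumDomain]. *)
HB.mixin Record UnitAlgebra_isCStarAlgebra (R : realType) A
    of GRing.UnitAlgebra R[i] A := {
  star : A -> A ;
  starK : involutive star ;
  starD : {morph star : x y / x + y} ;
  starZ : forall (c : R[i]) (x : A), star (c *: x) = c^* *: star x ;
  starM : forall x y : A, star (x * y) = star y * star x ;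
  cnorm : A -> R ;
  cnorm_eq0 : forall x : A, cnorm x = 0 -> x = 0 ;
  cnormD_le : forall x y : A, cnorm (x + y) <= cnorm x + cnorm y ;
  cnormZ : forall (c : R[i]) (x : A),
    (cnorm (c *: x))%:C%C = `|c| * (cnorm x)%:C%C ;
  cnormM_le : forall x y : A, cnorm (x * y) <= cnorm x * cnorm y ;
  cnorm_starM : forall x : A, cnorm (star x * x) = cnorm x ^+ 2 ;
  cnorm_complete : forall u : nat -> A,
    (forall e : R, 0 < e -> exists N : nat, forall m n : nat,
      (N <= m)%N -> (N <= n)%N -> cnorm (u m - u n) < e) ->
    exists l : A, forall e : R, 0 < e -> exists N : nat, forall n : nat,
      (N <= n)%N -> cnorm (u n - l) < e
}.

#[short(type="cstarAlgType")]
HB.structure Definition CStarAlgebra (R : realType) :=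
  {A of UnitAlgebra_isCStarAlgebra R A & GRing.UnitAlgebra R[i] A}.

Section PoincareHalfSpace.
Variables (R : realType) (A : cstarAlgType R).
Implicit Types (x h : A) (a : 'M[A]_2) (X Y : 'cV[A]_2).

Definition spectrum x : set R[i] :=
  [set l | (l%:A - x : A) \isn't a GRing.unit].

(* The order of R[i] satisfies [0 <= l] iff l is real and nonnegative. *)
Definition positive x : Prop :=
  star x = x /\ forall l, spectrum x l -> 0 <= l.

Definition Gplus : set A := [set x | positive x /\ x \is a GRing.unit].

Definition imag h : A := (2 * 'i)^-1 *: (h - star h).

Definition half_space : set A := [set h | Gplus (imag h)].

(* [unitmx] requires commutative coefficients. *)
Definition GL2 : set 'M[A]_2 :=
  [set a | exists a' : 'M[A]_2, a *m a' = 1%:M /\ a' *m a = 1%:M].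

(* The coordinates x_1, x_2 are the entries of index 0, 1; likewise the
   coefficient a_11 of a matrix is [a 0 0], etc. *)
Definition thetaH X Y : A :=
  'i^-1 *: (star (X 0 0) * Y 1 0 - star (X 1 0) * Y 0 0).

Definition UthetaH : set 'M[A]_2 :=
  [set a | GL2 a /\ forall X Y, thetaH (a *m X) (a *m Y) = thetaH X Y].

Definition borel : set 'M[A]_2 := [set a | UthetaH a /\ a 0 1 = 0].

(* [_^-1] is the identity on non-units, but for h in [half_space] and a in
   [UthetaH] the denominator is a unit; for a in [borel], the only case needed
   for transitivity, see [borel_unit] below. *)
Definition act a h : A := (a 1 0 + a 1 1 * h) * (a 0 0 + a 0 1 * h)^-1.

Definition transitive_on (G : set 'M[A]_2) (op : 'M[A]_2 -> A -> A)
    (S : set A) : Prop :=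
  forall h k, S h -> S k -> exists a, G a /\ op a h = k.

Lemma borel_unit a h : borel a -> a 0 0 + a 0 1 * h \is a GRing.unit.
Proof.
move=> [[[a' [aa' _]] aU] a01]; rewrite a01 mul0r addr0.
have star0 : star (0 : A) = 0.
  by have := starZ 0 (0 : A); rewrite !scale0r conjC0 scale0r.
have star1 : star (1 : A) = 1.
  by have := starM (star (1 : A)) 1; rewrite mulr1 starK mulr1.
have right_inv : a 0 0 * a' 0 0 = 1.
  have /(congr1 (fun M : 'M[A]_2 => M 0 0)) := aa'.
  by rewrite !mxE big_ord_recl big_ord1 (_ : lift _ _ = 1);
    [rewrite a01 mul0r addr0|exact/val_inj].
have left_inv : star (a 1 1) * a 0 0 = 1.
  pose e (k : 'I_2) : 'cV[A]_2 := delta_mx k 0.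
  have ae i k : (a *m e k) i 0 = a i k.
    by rewrite -[a *m _]colE mxE.
  have := aU (e 0) (e 1); rewrite /thetaH !ae a01 !mxE /= mulr0 subr0.
  rewrite !mulr0 subr0 star1 mulr1.
  move/(congr1 ( *:%R 'i)); rewrite !scalerA mulfV ?neq0Ci// !scale1r.
  by move/(congr1 star); rewrite starM starK star1.
apply/unitrP; exists (star (a 1 1)); split=> //.
rewrite (_ : star _ = a' 0 0)//.
by rewrite -[LHS]mulr1 -right_inv mulrA left_inv mul1r.
Qed.

End PoincareHalfSpace.

(* Main.v *)
(** Transitivity of the lower triangular group reduces to: for [p = Im h] and
    [q = Im k] there is an invertible [v] with [q = v^* p v]. Functional calculus
    is avoided. All points of the segment from [1] to a positive invertible [p]
    are self-adjoint and invertible, and any two sufficiently close points [x], [y]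
    of it are congruent: the square root [v] of [x^-1 y], obtained as a fixed
    point near [1], satisfies [x v = v^* x], so [v^* x v = x v v = y]. Congruence
    is an equivalence relation and the segment is connected, so [p] is congruent
    to [1]. *)
Require Import Defs.
From mathcomp Require Import all_boot all_order all_algebra.
From mathcomp Require Import complex.
From mathcomp Require Import boolp classical_sets reals.
From mathcomp Require Import lra.

Set Implicit Arguments.
Unset Strict Implicit.
Unset Printing Implicit Defensive.

Import Order.TTheory GRing.Theory Num.Theory.

Local Open Scope classical_set_scope.
Local Open Scope ring_scope.

(** Let [T] be the supremum of the points where [P] holds. Near [T] the truth value of [P] is
    constant, and [P] holds at points at or arbitrarily close below [T]; hence it holds at [T], and
    also beyond [T] unless [T = 1]. *)
Lemma unit_interval_locally_constant (R : realType) (P : R -> Prop) :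
    (forall t : R, 0 <= t <= 1 -> exists2 d : R, 0 < d &
      forall s : R, 0 <= s <= 1 -> `|s - t| < d -> P s <-> P t) ->
  P 0 -> P 1.
Proof.
move=> locP P0; pose S := [set t : R | 0 <= t <= 1 /\ P t].
have S0 : S 0 by rewrite /S /= lexx ler01.
have ubS : ubound S 1 by move=> t [/andP[]].
have supS : has_sup S by split; [exists 0 | exists 1].
pose T := sup S.
have T0 : 0 <= T by apply: ub_le_sup => //; exists 1.
have T1 : T <= 1 by apply: ge_sup => //; exists 0.
have [|d d0 Pd] := locP T; first by rewrite T0 T1.
have [s [s01 Ps] sT] := sup_adherent d0 supS.
have lesT : s <= T by apply: ub_le_sup => //; exists 1.
have PT : P T.
  apply/(Pd s) => //.
  by rewrite ler0_norm ?subr_le0// opprB ltrBlDl -ltrBlDr.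
have [->//|T1'] := eqVneq 1 T.
have {T1'} ltT1 : T < 1 by rewrite lt_neqAle eq_sym T1' T1.
pose r := Num.min 1 (T + d / 2).
have ltTr : T < r by rewrite lt_min ltT1/= ltrDl divr_gt0.
have r01 : 0 <= r <= 1 by rewrite ge_min lexx/= andbT (le_trans T0)// ltW.
have rd : r <= T + d / 2 by rewrite ge_min lexx orbT.
have : r <= T.
  apply: ub_le_sup; first by exists 1.
  split => //; apply/(Pd r) => //.
  by rewrite gtr0_norm ?subr_gt0//; lra.
by rewrite leNgt ltTr.
Qed.

Section CStarAlgebraTheory.
Variables (R : realType) (A : cstarAlgType R).
Implicit Types (p q x y u v : A).

(** * Involution and norm *)

Lemma star0 : star (0 : A) = 0.
Proof. by have := starZ 0 (0 : A); rewrite !scale0r conjC0 scale0r. Qed.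

Lemma star1 : star (1 : A) = 1.
Proof. by have := starM (star (1 : A)) 1; rewrite mulr1 starK mulr1. Qed.

Lemma starN x : star (- x) = - star x.
Proof. by rewrite -scaleN1r starZ rmorphN1 scaleN1r. Qed.

Lemma starB x y : star (x - y) = star x - star y.
Proof. by rewrite starD starN. Qed.

Lemma starZ_real (c : R) x : star (c%:C%C *: x) = c%:C%C *: star x.
Proof. by rewrite starZ; congr (_ *: _); exact: conjc_real. Qed.

Lemma star_unit x : x \is a GRing.unit -> star x \is a GRing.unit.
Proof.
move=> xU; apply/unitrP; exists (star x^-1).
by rewrite -!starM divrr// mulVr// star1.
Qed.

Lemma starV x : x \is a GRing.unit -> star x^-1 = (star x)^-1.
Proof.
move=> xU; apply: (mulrI (star_unit xU)).
by rewrite -starM mulVr// divrr ?star1 ?star_unit.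
Qed.

Lemma cnormZ_real (c : R) x : cnorm (c%:C%C *: x) = `|c| * cnorm x.
Proof.
have := cnormZ c%:C%C x; rewrite normc_def/= expr0n/= addr0 sqrtr_sqr.
by rewrite -rmorphM => /complexI.
Qed.

Lemma cnorm0 : cnorm (0 : A) = 0.
Proof. by have := cnormZ_real 0 0; rewrite scaler0 normr0 mul0r. Qed.

Lemma cnormN x : cnorm (- x) = cnorm x.
Proof.
by have := cnormZ_real (-1) x; rewrite rmorphN1 scaleN1r normrN1 mul1r.
Qed.

Lemma cnorm_ge0 x : 0 <= cnorm x.
Proof.
have := cnormD_le x (- x); rewrite subrr cnorm0 cnormN -mulr2n.
by rewrite pmulrn_lge0.
Qed.

Lemma cnormB_le x y : cnorm (x - y) <= cnorm x + cnorm y.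
Proof. by rewrite -(cnormN y) cnormD_le. Qed.

Lemma cnorm_distC x y : cnorm (x - y) = cnorm (y - x).
Proof. by rewrite -cnormN opprB. Qed.

(** The C*-identity and submultiplicativity give [cnorm y ^+ 2 <= cnorm (star y) * cnorm y]; the
    resulting bound is used for both [x] and [star x]. *)
Lemma cnorm_star x : cnorm (star x) = cnorm x.
Proof.
suff le_star y : cnorm y <= cnorm (star y).
  by apply/eqP; rewrite eq_le le_star -{1}[X in _ <= cnorm X]starK le_star.
have := cnormM_le (star y) y; rewrite cnorm_starM expr2.
have [->|y0] := eqVneq (cnorm y) 0; first by rewrite cnorm_ge0.
by rewrite ler_pM2r// lt_neqAle eq_sym y0 cnorm_ge0.
Qed.

(** * Norm limits and square roots near the unit *)

Definition ccvg (f : nat -> A) (l : A) := forall e : R, 0 < e ->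
  exists N : nat, forall n : nat, (N <= n)%N -> cnorm (f n - l) < e.

Lemma ccvg_unique f l l' : ccvg f l -> ccvg f l' -> l = l'.
Proof.
move=> fl fl'; apply/eqP; rewrite -subr_eq0; apply/eqP/cnorm_eq0.
apply/eqP; rewrite eq_le cnorm_ge0 andbT leNgt; apply/negP => e0.
have e20 : 0 < cnorm (l - l') / 2 by rewrite divr_gt0.
have [N fN] := fl _ e20; have [N' fN'] := fl' _ e20.
have := fN _ (leq_maxl N N'); have := fN' _ (leq_maxr N N').
set n := maxn N N' => n1 n2.
have : cnorm (l - l') <= cnorm (f n - l') + cnorm (f n - l).
  by rewrite -(subrKA (f n)) addrC -(cnormN (f n - l)) opprB cnormD_le.
by move: n1 n2; lra.
Qed.

Lemma ccvgS f l : ccvg f l -> ccvg (fun n => f n.+1) l.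
Proof. by move=> fl e /fl[N fN]; exists N => n Nn; rewrite fN// ltnW. Qed.

(** The bound is asked only between the terms and the limit, so that maps that are Lipschitz merely
    on a ball qualify. *)
Lemma ccvg_lipschitz (k : R) (F : A -> A) f l :
    (forall n, cnorm (F (f n) - F l) <= k * cnorm (f n - l)) ->
  ccvg f l -> ccvg (fun n => F (f n)) (F l).
Proof.
move=> Fk fl e e0; have k0 : 0 < `|k| + 1 by rewrite ltr_wpDl.
have [N fN] := fl _ (divr_gt0 e0 k0); exists N => n /fN.
rewrite ltr_pdivlMr// => /(le_lt_trans _); apply.
rewrite (le_trans (Fk n))// mulrC ler_wpM2l ?cnorm_ge0//.
by rewrite (le_trans (ler_norm k))// lerDl.
Qed.

Lemma cauchy_geometric f (c : R) :
  (forall n, cnorm (f n.+1 - f n) <= c * 2^-1 ^+ n) -> exists l, ccvg f l.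
Proof.
move=> fc; apply: cnorm_complete.
have c0 : 0 <= c by have := fc 0%N; rewrite expr0 mulr1; apply/le_trans/cnorm_ge0.
(* Telescoping: the right-hand side is the exact sum of the bounds on the [k] successive
   differences. *)
have dist n k : cnorm (f (n + k)%N - f n) <= 2 * c * (2^-1 ^+ n - 2^-1 ^+ (n + k)).
  elim: k => [|k IH]; first by rewrite addn0 !subrr cnorm0 mulr0.
  rewrite addnS -(subrKA (f (n + k)%N)) (le_trans (cnormD_le _ _))//.
  by have := fc (n + k)%N; move: IH; rewrite exprS; lra.
(* Since [N * 2^-1 ^+ N <= 1], such an [N] brings [2 * c * 2^-1 ^+ N] below [e / 2]. *)
move=> e e0; have [N cN] : exists N : nat, 4 * c / e < N%:R.
  by exists (Num.bound (4 * c / e)); rewrite archi_boundP// divr_ge0 ?mulr_ge0// ltW.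
have tailN n : (N <= n)%N -> cnorm (f n - f N) < e / 2.
  move=> /subnKC <-; apply: le_lt_trans (dist _ _) _.
  have : 2^-1 ^+ N * N%:R <= 1 :> R.
    rewrite exprVn ler_pdivrMl ?exprn_gt0// mulr1 -natrX ler_nat ltnW//.
    exact: ltn_expl.
  have : 0 <= 2^-1 ^+ (N + (n - N)) :> R by rewrite exprn_ge0 ?invr_ge0.
  have : 0 < 2^-1 ^+ N :> R by rewrite exprn_gt0 ?invr_gt0.
  move: cN; rewrite ltr_pdivrMr//.
  set a := 2^-1 ^+ N; set b := 2^-1 ^+ _; set m := N%:R.
  move=> cN a0 b0 aN.
  have := ler_wpM2r (ltW e0) aN; rewrite mul1r => aNe.
  have : 4 * c * a < e.
    by apply: lt_le_trans aNe; rewrite mulrC -mulrA ltr_pM2l.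
  have := mulr_ge0 c0 b0; lra.
exists N => m n /tailN mN /tailN nN; rewrite -(subrKA (f N)).
by rewrite (le_lt_trans (cnormD_le _ _))// (cnorm_distC _ (f n)); lra.
Qed.

(* [1 + u] is a square root of [1 + x] iff [u = (x - u ^+ 2) / 2], a contraction
   for small [x]; the intertwining relation passes to the iterates. *)
Lemma sqrt_near1 p x : p * x = star x * p -> cnorm x <= 4^-1 ->
  exists2 v, v * v = 1 + x & p * v = star v * p.
Proof.
move=> px x4; pose F u := (2^-1)%:C%C *: (x - u * u).
pose f n := iter n F 0.
(* [F] preserves the ball of radius 1/4, because (1/4 + 1/16) / 2 < 1/4. *)
have normF u : cnorm u <= 4^-1 -> cnorm (F u) <= 4^-1.
  move=> u4; rewrite cnormZ_real gtr0_norm ?invr_gt0//.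
  have := cnormB_le x (u * u); have := cnormM_le u u; have := cnorm_ge0 u.
  by nra.
have normf n : cnorm (f n) <= 4^-1.
  by elim: n => [|n IH]; [rewrite cnorm0 invr_ge0 | exact: normF].
have lipF u w : cnorm u <= 4^-1 -> cnorm w <= 4^-1 ->
    cnorm (F u - F w) <= 2^-1 * cnorm (u - w).
  move=> u4 w4; rewrite -scalerBr cnormZ_real gtr0_norm ?invr_gt0//.
  rewrite ler_pM2l ?invr_gt0// opprB addrC addrA subrK (cnorm_distC u).
  have -> : w * w - u * u = w * (w - u) + (w - u) * u.
    by rewrite mulrBr mulrBl addrA subrK.
  have := cnormD_le (w * (w - u)) ((w - u) * u).
  have := cnormM_le w (w - u); have := cnormM_le (w - u) u.
  by have := cnorm_ge0 (w - u); nra.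
have [u fu] : exists u, ccvg f u.
  apply: (@cauchy_geometric _ 1) => n; rewrite mul1r.
  elim: n => [|n IH].
    rewrite expr0 (le_trans (cnormB_le _ _))// cnorm0 addr0.
    by rewrite (le_trans (normf 1%N))//; lra.
  apply: le_trans (lipF _ _ (normf n.+1) (normf n)) _.
  by rewrite exprS ler_pM2l ?invr_gt0.
have u4 : cnorm u <= 4^-1.
  rewrite leNgt; apply/negP; rewrite -subr_gt0 => /fu[N /(_ _ (leqnn _))].
  have := cnormB_le (f N) (f N - u); have := normf N.
  by rewrite opprB addrCA subrr addr0; lra.
have Fu : F u = u.
  apply: ccvg_unique (ccvgS fu); apply: ccvg_lipschitz fu => n.
  exact: lipF.
have pf n : p * f n = star (f n) * p.
  elim: n => [|n IH]; first by rewrite star0 mulr0 mul0r.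
  rewrite /= -!/(f n) starZ_real -scalerAr -scalerAl starB mulrBr mulrBl px.
  by rewrite starM mulrA IH -mulrA IH mulrA.
have pu : p * u = star u * p.
  apply/eqP; rewrite -subr_eq0; apply/eqP.
  (* [G] is Lipschitz and vanishes at every [f n], so [G u] and [0] are limits of the same
     sequence. *)
  pose G w := p * w - star w * p.
  apply: (@ccvg_unique (fun n => G (f n))); last first.
    by move=> e e0; exists 0%N => n _; rewrite /G pf !subrr cnorm0.
  apply: (@ccvg_lipschitz (cnorm p + cnorm p)) fu => n.
  have -> : G (f n) - G u = p * (f n - u) - star (f n - u) * p.
    by rewrite /G mulrBr starB mulrBl !opprD addrACA.
  apply: le_trans (cnormB_le _ _) _.
  have := cnormM_le p (f n - u); have := cnormM_le (star (f n - u)) p.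
  by rewrite cnorm_star; lra.
exists (1 + u); last by rewrite starD star1 mulrDr mulrDl pu mulr1 mul1r.
rewrite mulrDl mul1r mulrDr mulr1 -!addrA; congr (_ + _).
have : F u + F u = u + u by rewrite Fu.
rewrite /F -scalerDl -rmorphD/= (_ : 2^-1 + 2^-1 = 1); last lra.
by rewrite scale1r addrA => <-; rewrite subrK.
Qed.

(** * Congruence and its classes *)

Definition congruent p q :=
  exists2 v, v \is a GRing.unit & q = star v * p * v.

Lemma congruent_sym p q : congruent p q -> congruent q p.
Proof.
move=> [v vU ->]; exists v^-1; rewrite ?unitrV//.
by rewrite starV// !mulrA mulVr ?star_unit// mul1r mulrK.
Qed.

Lemma congruent_trans p q x : congruent p q -> congruent q x -> congruent p x.
Proof.
move=> [v vU ->] [w wU ->]; exists (v * w); rewrite ?unitrMl//.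
by rewrite starM !mulrA.
Qed.

(** For [x = p^-1 * (q - p)], both [p * x] and [star x * p] equal [q - p], so [sqrt_near1] applies,
    and [1 + x = p^-1 * q]. *)
Lemma congruent_near p q : star p = p -> star q = q ->
  p \is a GRing.unit -> q \is a GRing.unit ->
  cnorm (p^-1) * cnorm (q - p) <= 4^-1 -> congruent p q.
Proof.
move=> sp sq pU qU pq.
have [|/=|v vv pv] := @sqrt_near1 p (p^-1 * (q - p)).
- by rewrite starM starB starV// sp sq mulVKr// -mulrA mulVr// mulr1.
- exact: le_trans (cnormM_le _ _) pq.
have {}vv : v * v = p^-1 * q by rewrite vv mulrBr mulVr// subrKC.
have vvU : v * v \is a GRing.unit by rewrite vv unitrMl ?unitrV.
exists v; last by rewrite -pv -mulrA vv mulVKr.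
(* [v] commutes with the unit [v * v], which makes this left inverse two-sided. *)
apply/unitrP; exists ((v * v)^-1 * v); rewrite -mulrA mulVr//; split=> //.
have vC : GRing.comm v (v * v) by rewrite /GRing.comm mulrA.
by rewrite -(commrV vC) mulrA divrr.
Qed.

Lemma congruent1_Gplus p : Gplus p -> congruent 1 p.
Proof.
move=> [[sp pos] pU]; pose P t := 1 + t%:C%C *: (p - 1).
have sP t : star (P t) = P t by rewrite starD starZ_real starB sp star1.
have PU t : 0 <= t <= 1 -> P t \is a GRing.unit.
  move=> /andP[t0 t1].
  have [->|tn0] := eqVneq t 0; first by rewrite /P scale0r addr0 unitr1.
  have [->|tn1] := eqVneq t 1; first by rewrite /P scale1r addrCA subrr addr0.
  have {tn0}t0 : 0 < t by rewrite lt_neqAle eq_sym tn0.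
  have {tn1}t1 : t < 1 by rewrite lt_neqAle tn1.
  (* For [0 < t < 1], [P t] is a nonzero multiple of [l - p] with [l < 0], and a negative [l] is
     outside the spectrum of [p]. *)
  pose l : R := - ((1 - t) / t).
  have tl : P t = (- t)%:C%C *: (l%:C%C%:A - p).
    rewrite scalerBr scalerA -rmorphM/= rmorphN scaleNr opprK.
    rewrite /l mulrNN mulrC divfK ?gt_eqF// rmorphB scalerBl rmorph1 scale1r.
    by rewrite /P scalerBr addrAC -addrA.
  rewrite tl scaler_unit ?unitfE ?fmorph_eq0 ?oppr_eq0 ?gt_eqF//.
  apply/negPn/negP => /(pos l%:C%C); rewrite lecR.
  by rewrite leNgt oppr_lt0 divr_gt0 ?subr_gt0.
have P0 : P 0 = 1 by rewrite /P scale0r addr0.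
have P1 : P 1 = p by rewrite /P scale1r addrCA subrr addr0.
rewrite -P1.
apply: (@unit_interval_locally_constant R (fun t => congruent 1 (P t))).
  (* The factor 4 matches the threshold of [congruent_near]; the radius is [(k + 1)^-1] because [k]
     may vanish. *)
  move=> t t01; pose k := 4 * (cnorm (P t)^-1 * cnorm (p - 1)).
  have k0 : 0 <= k by rewrite !mulr_ge0// cnorm_ge0.
  have k1 : 0 < k + 1 by rewrite ltr_wpDl.
  exists (k + 1)^-1; first by rewrite invr_gt0.
  move=> s s01 st.
  suff Pts : congruent (P t) (P s).
    by split=> [/congruent_trans|/congruent_trans]; apply=> //; exact: congruent_sym.
  apply: congruent_near; rewrite ?PU//.
  have -> : P s - P t = (s - t)%:C%C *: (p - 1).
    by rewrite /P opprD addrACA subrr add0r -scalerBl -rmorphB.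
  rewrite cnormZ_real.
  move: st; rewrite -div1r ltr_pdivlMr// /k.
  by have := normr_ge0 (s - t); lra.
by rewrite P0; exists 1; rewrite ?unitr1// star1 !mulr1.
Qed.

(** * Lower triangular matrices *)

Lemma mulmx2E n (a : 'M[A]_2) (X : 'M[A]_(2, n)) i j :
  (a *m X) i j = a i 0 * X 0 j + a i 1 * X 1 j.
Proof.
rewrite mxE big_ord_recl big_ord1.
by congr (_ + _ * X _ _); [congr (a _ _)|]; exact/val_inj.
Qed.

Definition lower_trig (x y z : A) : 'M[A]_2 :=
  \matrix_(i, j) if i == 0 then if j == 0 then x else 0
                 else if j == 0 then y else z.

Lemma mul_lower_trig x y z x' y' z' :
  lower_trig x y z *m lower_trig x' y' z' =
  lower_trig (x * x') (y * x' + z * y') (z * z').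
Proof.
apply/matrixP => i j; rewrite mulmx2E !mxE/=.
by case: eqP => _; case: eqP => _; rewrite ?(mulr0, mul0r, addr0, add0r).
Qed.

Lemma lower_trig1 : lower_trig 1 0 1 = 1%:M.
Proof. by apply/matrixP => -[[|[|//]] ?] [[|[|//]] ?]; rewrite !mxE. Qed.

(** This matrix acts by [h |-> star v * h * v + c]: a congruence followed by a self-adjoint
    translation. *)
Lemma lower_trig_borel v c : v \is a GRing.unit -> star c = c ->
  borel (lower_trig v^-1 (c * v^-1) (star v)).
Proof.
move=> vU sc; have svU := star_unit vU.
split; last by rewrite mxE.
split.
  exists (lower_trig v (- (star v)^-1 * c) (star v)^-1).
  rewrite !mul_lower_trig -lower_trig1 !(mulVr, divrr)//.
  by rewrite mulrVK// mulNr mulrN mulVKr// subrr mulNr mulrA addNr.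
move=> X Y; rewrite /thetaH !mulmx2E !mxE/= !mul0r !addr0 !starM !starD !starM.
rewrite starK starV// sc; congr (_ *: _).
rewrite mulrDr mulrDl !mulrA mulrVK// mulrK//.
by rewrite opprD addrACA subrr add0r.
Qed.

End CStarAlgebraTheory.

Theorem proposition6p3 (R : realType) (A : cstarAlgType R) :
  transitive_on (@borel R A) (@act R A) (@half_space R A).
Proof.
move=> h k hH kH.
have [v vU khv] := congruent_trans
  (congruent_sym (congruent1_Gplus hH)) (congruent1_Gplus kH).
have {}khv : k - star k = star v * (h - star h) * v.
  move: khv; rewrite /imag -scalerAr -scalerAl; apply: scalerI.
  by rewrite invr_eq0 mulf_neq0 ?neq0Ci// pnatr_eq0.
(* The translation part [k - star v * h * v] is self-adjoint because, by [khv], [k] and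
   [star v * h * v] have the same imaginary part. *)
exists (lower_trig v^-1 ((k - star v * h * v) * v^-1) (star v)); split.
  apply: lower_trig_borel => //; rewrite starB !starM starK mulrA.
  by rewrite -[star k](subKr k) khv mulrBr mulrBl opprB addrA addrAC addrK.
rewrite /act !mxE /= mul0r addr0 invrK mulrDl divrK//.
by rewrite subrK.
Qed.
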